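(* Let $Y$ be a real-valued random variable and $\mathbf{X}$ a random vector in $\mathbb{R}^p$ such that the central subspace $\mathcal{S}_{Y|\mathbf{X}}$ exists, and let $\mathcal{H}$ be a linear subspace of $\mathbb{R}^p$. Then $P_{\mathcal{H}}\mathcal{S}_{Y|\mathbf{X}} = \mathcal{O}_p$ if and only if $Y$ is conditionally independent of $P_{\mathcal{H}}\mathbf{X}$ given $Q_{\mathcal{H}}\mathbf{X}$.
   Context: For a linear subspace $\mathcal{S}\subseteq\mathbb{R}^p$, $P_{\mathcal{S}}$ denotes the orthogonal projection onto $\mathcal{S}$ in the standard inner product, and $Q_{\mathcal{S}} = I_p - P_{\mathcal{S}}$. $\mathcal{O}_p=\{0\}$ denotes the origin in $\mathbb{R}^p$, and $P_{\mathcal{H}}\mathcal{S}_{Y|\mathbf{X}}$ is the image of $\mathcal{S}_{Y|\mathbf{X}}$ under $P_{\mathcal{H}}$. A linear subspace $\mathcal{S}$ of $\mathbb{R}^p$ is a dimension reduction subspace if $Y$ is conditionally independent of $\mathbf{X}$ given $P_{\mathcal{S}}\mathbf{X}$. The central subspace $\mathcal{S}_{Y|\mathbf{X}}$ is the intersection of all dimension reduction subspaces; it is said to exist when this intersection is itself a dimension reduction subspace. *)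

(* Defs.v *)
From HB Require Import structures.
From mathcomp Require Import all_boot all_order all_algebra.
From mathcomp Require Import sesquilinear.
From mathcomp Require Import all_classical all_reals all_analysis.

Set Implicit Arguments.
Unset Strict Implicit.
Unset Printing Implicit Defensive.

Import Order.TTheory GRing.Theory Num.Theory.
Import numFieldNormedType.Exports.

Local Open Scope classical_set_scope.
Local Open Scope ring_scope.

(* R^p is 'rV[R]_p with the product sigma-algebra, generated by the coordinate
   maps as for the library's n.-tuple; it is the Borel sigma-algebra of R^p. *)
Section measurable_rV.
Context {R : realType} {p : nat}.

Let coors : 'I_p -> 'rV[R]_p -> R := fun i x => x 0 i.

Let rV_set0 : g_sigma_preimage coors set0.
Proof. exact: sigma_algebra0. Qed.

Let rV_setC A : g_sigma_preimage coors A -> g_sigma_preimage coors (~` A).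
Proof. exact: sigma_algebraC. Qed.

Let rV_bigcup (F : (set 'rV[R]_p)^nat) :
  (forall i, g_sigma_preimage coors (F i)) ->
  g_sigma_preimage coors (\bigcup_i (F i)).
Proof. exact: sigma_algebra_bigcup. Qed.

HB.instance Definition _ := @isMeasurable.Build default_measure_display
  'rV[R]_p (g_sigma_preimage coors) rV_set0 rV_setC rV_bigcup.

End measurable_rV.

Section dot_product.
Context {R : realType} {p : nat}.
Implicit Types u v : 'rV[R]_p.

Definition dotrv u v : R := \sum_(i < p) u 0 i * v 0 i.

Let dotrvC u v : dotrv u v = (-1) ^+ false * idfun (dotrv v u).
Proof. by rewrite mul1r; apply: eq_bigr => i _; rewrite mulrC. Qed.

Let dotrv_linear u : linear_for *%R (dotrv u).
Proof.
move=> a v w; rewrite /dotrv mulr_sumr -big_split /=.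
by apply: eq_bigr => i _; rewrite !mxE mulrDr mulrCA.
Qed.

Let dotrv_linearl v : linear_for *%R (dotrv^~ v).
Proof.
move=> a u w; rewrite /= /dotrv mulr_sumr -big_split /=.
by apply: eq_bigr => i _; rewrite !mxE mulrDl mulrA.
Qed.

Let dotrv_gt0 u : u != 0 -> 0 < dotrv u u.
Proof.
move=> u0; have /existsP[i ui] : [exists i, u 0 i != 0].
  apply: contraNT u0; rewrite negb_exists => /forallP u0.
  by apply/eqP/rowP => i; rewrite mxE; apply/eqP; move: (u0 i); rewrite negbK.
rewrite /dotrv (bigD1 i) //= ltr_wpDr ?sumr_ge0 //.
  by move=> j _; rewrite -expr2 sqr_ge0.
by rewrite -expr2 exprn_even_gt0.
Qed.

HB.instance Definition _ := @bilinear_isBilinear.Build R 'rV[R]_p 'rV[R]_p R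
  *%R (idfun \; *%R) dotrv (conj dotrv_linearl dotrv_linear).
HB.instance Definition _ := @isHermitianSesquilinear.Build R 'rV[R]_p false
  idfun dotrv dotrvC.
HB.instance Definition _ := @isDotProduct.Build R 'rV[R]_p dotrv dotrv_gt0.

End dot_product.

Section orthogonal_projection.
Context {R : realType} {p : nat}.
Implicit Types (S : {vspace 'rV[R]_p}) (u v : 'rV[R]_p).

(* Projection onto S along the orthogonal complement of S; orth_projP is the
   usual characterization. *)
Definition orth_proj S : 'End('rV[R]_p) :=
  daddv_pi S (orthov (@dotrv R p) S).

Definition orth_coproj S : 'End('rV[R]_p) := \1%VF - orth_proj S.

Lemma capv_orthov S : (S :&: orthov (@dotrv R p) S = 0)%VS.
Proof.
apply/eqP; rewrite -subv0; apply/subvP => v.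
rewrite memv_cap memv0 => /andP[vS /mem_orthovP/(_ v vS) v0].
by apply: contra_eqT v0 => v_neq0; rewrite gt_eqF ?neq0_dnorm_gt0.
Qed.

Lemma addv_orthov S : (S + orthov (@dotrv R p) S = fullv)%VS.
Proof.
apply/eqP; rewrite eqEdim subvf /=.
have -> : \dim (S + orthov (@dotrv R p) S) =
          (\dim S + \dim (orthov (@dotrv R p) S))%N.
  by have := dimv_sum_cap S (orthov (@dotrv R p) S);
     rewrite capv_orthov dimv0 addn0.
pose f v : 'rV[R]_(\dim S) := \row_i dotrv v (vbasis S)`_i.
have f_lin : linear f.
  by move=> a u v; apply/rowP => i; rewrite !mxE linearPl.
pose fL : {linear 'rV[R]_p -> 'rV[R]_(\dim S)} :=
  HB.pack f (GRing.isLinear.Build _ _ _ _ f f_lin).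
have kerf : (lker (linfun fL) <= orthov (@dotrv R p) S)%VS.
  apply/subvP => v; rewrite memv_ker lfunE /= => /eqP/rowP fv0.
  apply/mem_orthovP => w /coord_vbasis ->; rewrite linear_sumr big1 //= => i _.
  by have := fv0 i; rewrite !mxE linearZr_LR /= => ->; rewrite mulr0.
rewrite -(limg_ker_dim (linfun fL) fullv) capfv addnC.
rewrite leq_add ?dimvS //.
by rewrite (leq_trans (dimvS (subvf _))) // dimvf /dim /= mul1n.
Qed.

Lemma orth_projP S v u :
  u = orth_proj S v <-> u \in S /\ {in S, forall s, dotrv (v - u) s = 0}.
Proof.
have Pv : v - orth_proj S v \in orthov (@dotrv R p) S.
  have vS : v \in (S + orthov (@dotrv R p) S)%VS by rewrite addv_orthov memvf.
  rewrite -{1}(daddv_pi_add (capv_orthov S) vS) [X in X - _]addrC addrK.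
  exact: memv_pi.
split=> [->|[uS /mem_orthovP vu]].
  by split; [exact: memv_pi|exact/mem_orthovP].
apply/eqP; rewrite -subr_eq0 -memv0 -(capv_orthov S) memv_cap.
rewrite rpredB ?memv_pi //=.
have -> : u - orth_proj S v = (v - orth_proj S v) - (v - u).
  by rewrite opprB [RHS]addrC addrA subrK.
exact: rpredB.
Qed.

End orthogonal_projection.

Section conditional_independence.
Context {R : realType} {d : measure_display} {T : measurableType d}.
Variable P : probability T R.

(* f is a version of the conditional probability P(E | sigma(Z)); it is unique
   up to P-almost sure equality. *)
Definition is_cond_prob {d' : measure_display} {T' : measurableType d'}
    (Z : T -> T') (E : set T) (f : T -> R) : Prop :=
  [/\ measurable_fun [set: g_sigma_algebra_preimageType Z] f,
      P.-integrable [set: T] (EFin \o f) &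
      forall C, g_sigma_algebra_preimage Z C ->
        (\int[P]_(w in C) (f w)%:E = P (E `&` C))%E].

(* P(Y in A, X in B | Z) = P(Y in A | Z) P(X in B | Z) almost surely.  Versions
   always exist and are a.s. unique, so quantifying over some versions or over
   all of them is the same. *)
Definition cond_indep {d1 d2 d3 : measure_display} {T1 : measurableType d1}
    {T2 : measurableType d2} {T3 : measurableType d3}
    (Y : T -> T1) (X : T -> T2) (Z : T -> T3) : Prop :=
  forall (A : set T1) (B : set T2), measurable A -> measurable B ->
  exists fAB fA fB : T -> R,
    [/\ is_cond_prob Z (Y @^-1` A `&` X @^-1` B) fAB,
        is_cond_prob Z (Y @^-1` A) fA,
        is_cond_prob Z (X @^-1` B) fB &
        {ae P, forall w, fAB w = fA w * fB w}].

End conditional_independence.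

Section central_subspace.
Context {R : realType} {d : measure_display} {T : measurableType d} {p : nat}.
Variables (P : probability T R) (Y : {RV P >-> R}) (X : {RV P >-> 'rV[R]_p}).

Definition dim_reduction_subspace (S : {vspace 'rV[R]_p}) : Prop :=
  cond_indep P Y X (orth_proj S \o X).

Definition central_subspace : set 'rV[R]_p :=
  \bigcap_(S in dim_reduction_subspace) [set` S].

Definition central_subspace_exists : Prop :=
  exists2 S, dim_reduction_subspace S & [set` S] = central_subspace.

End central_subspace.

(* Main.v *)
(* Conditional independence of Y and X given Z says that P(Y in A | Z) is a
   version of P(Y in A | X, Z).  This criterion passes from (X, Z) to any pair
   (X', Z') of functions of (X, Z) such that Z is a function of Z'.  Applied to
   X' = P_H X + Q_H X = X and Z' = Q_H X, it shows that the independence of Y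
   and P_H X given Q_H X makes the orthogonal complement of H a dimension
   reduction subspace, which then contains the central subspace S.  Conversely,
   if S is orthogonal to H, then P_S X = P_S (Q_H X), and the criterion passes
   from (X, P_S X) to (P_H X, Q_H X). *)
From HB Require Import structures.
Require Import Defs.
From mathcomp Require Import all_boot all_order all_algebra.
From mathcomp Require Import all_classical all_reals all_analysis.
From mathcomp Require Import measurable_realfun.

Set Implicit Arguments.
Unset Strict Implicit.
Unset Printing Implicit Defensive.

Import Order.TTheory GRing.Theory Num.Theory.
Import numFieldNormedType.Exports.

Local Open Scope classical_set_scope.
Local Open Scope ring_scope.

(** * Measurability of maps between finite-dimensional real spaces *)

Section measurable_rV_theory.
Context {R : realType}.

(** Both sides say that the sigma-algebra generated by the coordinates of [f] consists of measurable
    sets: generated sigma-algebras commute with preimages, so testing generators is enough. *)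
Lemma measurable_rVP {d} {T : measurableType d} {p} (f : T -> 'rV[R]_p) :
  measurable_fun [set: T] f <->
  forall i, measurable_fun [set: T] (fun x => f x 0 i).
Proof.
apply: (@iff_trans _ (g_sigma_preimage
    (fun i => (fun v : 'rV[R]_p => v 0 i) \o f) `<=` measurable)).
  rewrite g_sigma_preimage_comp; split=> [mf A [/= C preC <-]|prefS].
    exact: mf.
  by move=> _ A mA; apply: prefS; exists A.
split=> [fS i|mf].
- move=> _ A mA.
  apply: fS; apply: sub_sigma_algebra.
  (* Rewriting the finite union over ['I_p] as a union over [nat] goes through [inord], which needs
     a positive dimension. *)
  case: p => [|p] in f i *; first by case: i.
  rewrite -bigcup_mkord_ord.
  exists i; first exact: ltn_ord.
  by exists A => //; rewrite inord_val.
- apply: smallest_sub; first exact: sigma_algebra_measurable.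
  case: p => [|p] in f mf *; first by rewrite big_ord0.
  rewrite -bigcup_mkord_ord; apply: bigcup_sub => i Ii.
  by move=> A [B mB <-]; exact: mf.
Qed.

Lemma measurable_coord p (i : 'I_p) :
  measurable_fun [set: 'rV[R]_p] (fun v : 'rV[R]_p => v 0 i).
Proof. by move: i; apply/measurable_rVP; exact: measurable_id. Qed.

Lemma measurable_addrv p :
  measurable_fun [set: 'rV[R]_p * 'rV[R]_p] (fun v => v.1 + v.2).
Proof.
apply/measurable_rVP => i; under eq_fun do rewrite mxE.
by apply: measurable_funD; apply: (measurableT_comp (measurable_coord i)).
Qed.

Lemma measurable_linear_rV p q (f : {linear 'rV[R]_p -> 'rV[R]_q}) :
  measurable_fun [set: 'rV[R]_p] f.
Proof.
apply/measurable_rVP => i.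
have -> : (fun v => f v 0 i) =
    (fun v => \sum_j v 0 j * f (delta_mx 0 j) 0 i).
  apply/funext => v; rewrite {1}[v]row_sum_delta linear_sum summxE.
  by apply: eq_bigr => j _; rewrite linearZ mxE.
apply: measurable_sum => j; apply: measurable_funM => //.
exact: measurable_coord.
Qed.

End measurable_rV_theory.

(** * Integration against restrictions and images of finite measures *)

Section integral_mrestr.
Context {R : realType} {d : measure_display} {T : measurableType d}.
Variables (mu : {finite_measure set T -> \bar R}) (D : set T).
Hypothesis mD : measurable D.
Local Open Scope ereal_scope.

Lemma ge0_integral_mrestr C (f : T -> \bar R) : measurable C ->
    measurable_fun C f -> (forall x, 0 <= f x) ->
  \int[mrestr mu mD]_(x in C) f x = \int[mu]_(x in C `&` D) f x.
Proof.
move=> mC mf f0; pose nu : {finite_measure set T -> \bar R} := mrestr mu mD.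
have numu : nu `<< mu.
  apply/null_content_dominatesP => A mA A0.
  by apply: subset_measure0 A0 => //; exact: measurableI.
(* The density of mrestr mu mD with respect to mu is the indicator of D. *)
rewrite -[LHS](Radon_Nikodym_SigmaFinite.change_of_variables numu)//.
have h1 := Radon_Nikodym_SigmaFinite.f_integrable numu.
have h1D : ae_eq mu C (Radon_Nikodym_SigmaFinite.f nu mu) (EFin \o \1_D).
  apply: (ae_eq_subset (@subsetT _ C)); apply: integral_ae_eq => //.
  - exact/measurable_EFinP.
  - move=> A _ mA; rewrite -Radon_Nikodym_SigmaFinite.f_integral//.
    by rewrite /= integral_indic// setIC.
rewrite [RHS]integral_mkcondr epatch_indic; apply: ae_eq_integral => //.
- apply: emeasurable_funM => //; apply: measurable_funTS.
  exact: measurable_int h1.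
- apply: emeasurable_funM => //; apply: measurable_funTS.
  exact/measurable_EFinP.
- exact: ae_eqe_mul2l.
Qed.

Lemma integrable_mrestr C (f : T -> \bar R) : measurable C ->
  mu.-integrable C f -> (mrestr mu mD).-integrable C f.
Proof.
move=> mC fi; apply/integrableP; split; first exact: measurable_int fi.
rewrite ge0_integral_mrestr//.
  have /integrableP[_] : mu.-integrable (C `&` D) f; last by [].
  by apply: integrableS fi => //; exact: measurableI.
by apply: measurableT_comp => //; exact: measurable_int fi.
Qed.

Lemma integral_mrestr C (f : T -> \bar R) : measurable C ->
    measurable_fun C f ->
  \int[mrestr mu mD]_(x in C) f x = \int[mu]_(x in C `&` D) f x.
Proof.
move=> mC mf; rewrite integralE [RHS]integralE !ge0_integral_mrestr//.
- exact: measurable_funeneg.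
- exact: measurable_funepos.
Qed.

End integral_mrestr.

(* The library's measure instance on pushforward leaves the measurability proof
   to unification; carrying it as an argument, as mrestr does, avoids this. *)
Definition finite_pushforward d1 d2 (T1 : measurableType d1)
    (T2 : measurableType d2) (R : realType) (mu : set T1 -> \bar R)
    (f : T1 -> T2) (mf : measurable_fun [set: T1] f) := pushforward mu f.

Section finite_pushforward_measure.
Context d1 d2 (T1 : measurableType d1) (T2 : measurableType d2) (R : realType).
Variables (mu : {finite_measure set T1 -> \bar R}) (f : T1 -> T2).
Hypothesis mf : measurable_fun [set: T1] f.

Local Notation nu := (finite_pushforward mu mf).

Let nu0 : nu set0 = 0%E.
Proof. exact: measure0. Qed.

Let nu_ge0 A : (0 <= nu A)%E.
Proof. exact: measure_ge0. Qed.

Let nu_sigma_additive : semi_sigma_additive nu.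
Proof. exact: measure_semi_sigma_additive. Qed.

HB.instance Definition _ := isMeasure.Build _ _ _ nu
  nu0 nu_ge0 nu_sigma_additive.

Let nu_fin : fin_num_fun nu.
Proof.
move=> A mA; apply: fin_num_measure.
by rewrite -[X in measurable X]setTI; exact: mf.
Qed.

HB.instance Definition _ := Measure_isFinite.Build _ _ _ nu nu_fin.

End finite_pushforward_measure.

(** * Conditional probability given sigma(Z): uniqueness, existence, pulling out *)

Section conditional_probability.
Context {R : realType} {d : measure_display} {T : measurableType d}.
Variable P : probability T R.
Context {d' : measure_display} {T' : measurableType d'}.
Variable Z : T -> T'.
Hypothesis mZ : measurable_fun [set: T] Z.

(* Restricting P to sigma(Z) is its image under the identity T -> TZ, and
   P(E | sigma(Z)) is the density of P(E `&` _) on TZ. *)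
Let TZ := g_sigma_algebra_preimageType Z.
Let toZ : T -> TZ := id.

Lemma g_sigma_algebra_preimage_measurable C :
  g_sigma_algebra_preimage Z C -> measurable C.
Proof. by case=> B mB <-; exact: mZ. Qed.

Let mtoZ : measurable_fun [set: T] toZ.
Proof.
by move=> _ C mC; rewrite setTI; exact: g_sigma_algebra_preimage_measurable.
Qed.

Lemma measurable_fun_g_sigma_algebra_preimage d2 (T2 : measurableType d2)
    (f : T -> T2) :
  measurable_fun [set: TZ] f -> measurable_fun [set: T] f.
Proof. by move=> mf; exact: (measurableT_comp mf mtoZ). Qed.

Let PZ := finite_pushforward P mtoZ.

Let integral_PZ f C : measurable_fun [set: TZ] f ->
    P.-integrable [set: T] (EFin \o f) -> g_sigma_algebra_preimage Z C ->
  (\int[PZ]_(w in C) (f w)%:E = \int[P]_(w in C) (f w)%:E)%E.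
Proof.
move=> mf fi ZC; rewrite /PZ /finite_pushforward integral_pushforward//.
- exact/measurable_EFinP.
- by apply: integrableS fi => //; exact: g_sigma_algebra_preimage_measurable.
Qed.

(** Two versions have equal integrals over every measurable set of [TZ], hence agree [PZ]-almost
    everywhere; a null set of sigma(Z) is also a [P]-null set. *)
Lemma cond_prob_ae_unique E f g :
  is_cond_prob P Z E f -> is_cond_prob P Z E g ->
  {ae P, forall w, f w = g w}.
Proof.
move=> [mf fi fE] [mg gi gE].
have : ae_eq PZ [set: TZ] (EFin \o f) (EFin \o g).
  apply: integral_ae_eq => //.
  - apply: (integrable_pushforward mtoZ) => //; exact/measurable_EFinP.
  - exact/measurable_EFinP.
  - by move=> C _ mC; rewrite !integral_PZ// fE// gE.
move=> [N [mN N0 subN]]; exists N; split => //.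
  exact: g_sigma_algebra_preimage_measurable.
by move=> w fgw; apply: subN => /= /(_ I) [].
Qed.

Let integrable_PZ (f : TZ -> \bar R) : measurable_fun [set: TZ] f ->
  PZ.-integrable [set: TZ] f <-> P.-integrable [set: T] f.
Proof.
move=> mf; split; last by move=> fi; apply: (integrable_pushforward mtoZ).
move=> /integrableP[_ foo]; apply/integrableP; split.
  exact: measurable_fun_g_sigma_algebra_preimage.
move: foo; rewrite /PZ /finite_pushforward ge0_integral_pushforward//.
exact: measurableT_comp.
Qed.

(** With [g] the density of P(E [&] _) with respect to [P] on sigma(Z), integrating [f] against this
    measure is integrating [f * g] against [P]. A single [g] serves all integrable
    sigma(Z)-measurable [f]. *)
Lemma cond_prob_pull_out_exists E : measurable E ->
  exists2 g : T -> R, is_cond_prob P Z E g &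
    forall f, measurable_fun [set: TZ] f ->
    P.-integrable [set: T] (EFin \o f) ->
    P.-integrable [set: T] (EFin \o (f \* g)) /\
    forall C, g_sigma_algebra_preimage Z C ->
      (\int[P]_(w in C) (f w * g w)%:E = \int[P]_(w in C `&` E) (f w)%:E)%E.
Proof.
move=> mE.
pose nu := finite_pushforward (mrestr P mE) mtoZ.
have numu : nu `<< PZ.
  apply/null_content_dominatesP => A mA A0.
  have mA' := g_sigma_algebra_preimage_measurable mA.
  apply: (subset_measure0 (mu := P) _ mA' _ A0); first exact: measurableI.
  exact: subIsetl.
pose h := Radon_Nikodym_SigmaFinite.f nu PZ.
have h0 : forall x, (0 <= h x)%E by exact: Radon_Nikodym_SigmaFinite.f_ge0.
have hfin x : h x \is a fin_num by exact: Radon_Nikodym_SigmaFinite.f_fin_num.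
have hi : PZ.-integrable [set: TZ] h.
  exact: Radon_Nikodym_SigmaFinite.f_integrable.
pose g : T -> R := fine \o h.
have gE : EFin \o g = h by apply/funext => x /=; rewrite fineK.
have mg : measurable_fun [set: TZ] g.
  by apply/measurable_EFinP; rewrite gE; exact: measurable_int hi.
have gi : P.-integrable [set: T] (EFin \o g).
  by apply/integrable_PZ; [exact/measurable_EFinP|rewrite gE].
exists g.
  split => // C ZC; rewrite -integral_PZ//.
  transitivity (\int[PZ]_(w in C) h w)%E.
    by apply: eq_integral => w _; rewrite -gE.
  by rewrite -Radon_Nikodym_SigmaFinite.f_integral// setIC.
move=> f mf fi.
have fgi : P.-integrable [set: T] (EFin \o (f \* g)).
  apply/integrable_PZ.
    by apply/measurable_EFinP; exact: measurable_funM.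
  (* Integrability of the product with the density is obtained for nonnegative functions, so it is
     applied to [|f|], and [|f| * h] dominates [f * g]. *)
  have nf : nu.-integrable [set: TZ] (EFin \o (fun x => `|f x|)).
    apply: (integrable_pushforward mtoZ) => //.
      by apply/measurable_EFinP; exact: measurableT_comp.
    have fi1 := integrable_norm fi.
    by have := integrable_mrestr mE measurableT fi1.
  have := Radon_Nikodym_SigmaFinite.integrableM numu _ _ nf.
  move=> /(_ (fun x => normr_ge0 _) measurableT).
  apply: le_integrable => //.
    by apply/measurable_EFinP; exact: measurable_funM.
  move=> x _; rewrite abseM /= -/h -[h x]fineK//= -/(g x).
  by rewrite normrM normr_id lee_fin.
split=> // C ZC.
(* Both sides become integrals over [C] against [PZ]. The right one passes through the restriction
   of [P] to [E], then its image [nu], then the density of [nu]. *)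
rewrite -[LHS]integral_PZ//; last exact: measurable_funM.
have mC := g_sigma_algebra_preimage_measurable ZC.
have mfE : measurable_fun [set: TZ] (EFin \o f) by exact/measurable_EFinP.
have fCi : P.-integrable C (EFin \o f) by exact: integrableS fi.
rewrite -integral_mrestr//; last exact: measurable_int fCi.
have nfi : (mrestr P mE).-integrable C (EFin \o f) by exact: integrable_mrestr.
rewrite -[RHS](integral_pushforward mtoZ mfE nfi ZC).
rewrite -[RHS](Radon_Nikodym_change_of_variables numu ZC); last first.
  exact: (integrable_pushforward mtoZ mfE nfi ZC).
apply: ae_eq_integral => //.
- by apply/measurable_funTS/measurable_EFinP; exact: measurable_funM.
- apply/measurable_funTS; apply: emeasurable_funM => //.
(* The change of variables produces the Radon-Nikodym derivative of [nu] as a charge; it agrees with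
   [h] only almost everywhere. *)
- have := ae_eq_Radon_Nikodym_SigmaFinite numu ZC.
  move=> /(ae_eqe_mul2l (EFin \o f)).
  by congr ae_eq; apply/funext => w /=; rewrite EFinM fineK.
Qed.

End conditional_probability.

(** * Conditional independence expressed by integrals over events of sigma(X, Z) *)

Section cond_indep_theory.
Context {R : realType} {d : measure_display} {T : measurableType d}.
Variable P : probability T R.
Context {d1 d2 d3 : measure_display} {T1 : measurableType d1}
  {T2 : measurableType d2} {T3 : measurableType d3}.
Variables (Y : T -> T1) (X : T -> T2) (Z : T -> T3).
Hypotheses (mY : measurable_fun [set: T] Y) (mX : measurable_fun [set: T] X)
  (mZ : measurable_fun [set: T] Z).

Let mYA A : measurable A -> measurable (Y @^-1` A).
Proof. by move=> mA; rewrite -[X in measurable X]setTI; exact: mY. Qed.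

Let mXB B : measurable B -> measurable (X @^-1` B).
Proof. by move=> mB; rewrite -[X in measurable X]setTI; exact: mX. Qed.

Let ZC C : measurable C -> g_sigma_algebra_preimage Z (Z @^-1` C).
Proof. by move=> mC; exists C => //; rewrite setTI. Qed.

Let mZC C : measurable C -> measurable (Z @^-1` C).
Proof. by move=> mC; rewrite -[X in measurable X]setTI; exact: mZ. Qed.

Let XZ w := (X w, Z w).

Let mXZ : measurable_fun [set: T] XZ.
Proof. exact: measurable_fun_pair. Qed.

(** A pi-lambda argument: rectangles are stable under intersection and generate the product
    sigma-algebra, and the sets [D] satisfying the equality form a Dynkin system. Thus [f] has the
    integrals of a version of P(E | X, Z). *)
Lemma is_cond_prob_pair E f : measurable E -> is_cond_prob P Z E f ->
    (forall B C, measurable B -> measurable C ->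
      (\int[P]_(w in X @^-1` B `&` Z @^-1` C) (f w)%:E =
       P (E `&` (X @^-1` B `&` Z @^-1` C)))%E) ->
  forall D, measurable D ->
    (\int[P]_(w in XZ @^-1` D) (f w)%:E = P (E `&` XZ @^-1` D))%E.
Proof.
move=> mE [mf fi fE] fXZ D.
have mXZD D' : measurable D' -> measurable (XZ @^-1` D').
  by move=> mD'; rewrite -[X in measurable X]setTI; exact: mXZ.
have fiA A : measurable A -> P.-integrable A (EFin \o f).
  by move=> mA; exact: integrableS fi.
rewrite measurable_prod_measurableType; move: D; apply: dynkin_induction.
- exact: measurable_prod_measurableType.
- move=> _ _ [A1 mA1 [B1 mB1 <-]] [A2 mA2 [B2 mB2 <-]].
  exists (A1 `&` A2); first exact: measurableI.
  by exists (B1 `&` B2); [exact: measurableI|rewrite setXI].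
- by have := fXZ _ _ measurableT measurableT; rewrite !preimage_setT setIT.
- by move=> _ [B mB [C mC <-]]; exact: fXZ.
- move=> S mS IH; rewrite preimage_setC.
  have mS' := mXZD _ mS.
  have ET : (\int[P]_w (f w)%:E = P E)%E.
    have := fXZ _ _ measurableT measurableT.
    by rewrite !preimage_setT !setIT.
  have PES : P (E `&` XZ @^-1` S) \is a fin_num.
    by apply: fin_num_measure; exact: measurableI.
  (* Adding the finite mass over [S] to both sides reduces the complement to the case of the whole
     space. *)
  rewrite -[LHS](addeK _ PES) -[RHS](addeK _ PES); congr (_ - _)%E.
  rewrite -{1}IH -integral_setU ?setvU//; first last.
  + by rewrite disj_set_sym; apply/disj_setPCl.
  + exact: measurable_int fi.
  + exact: measurableC.
  rewrite ET -measureU//.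
  + by rewrite -setIUr setvU setIT.
  + by apply: measurableI => //; exact: measurableC.
  + exact: measurableI.
  + by rewrite setIACA setICl setI0.
- move=> F mF tF IH.
  have tXZF : trivIset [set: nat] (fun k => XZ @^-1` F k).
    apply/trivIsetP => i j _ _ ij; rewrite -preimage_setI.
    by move/trivIsetP : tF => /(_ _ _ I I ij) ->; rewrite preimage_set0.
  rewrite preimage_bigcup integral_bigcup//; last 2 first.
  + by move=> k; exact: mXZD.
  + by apply: fiA; apply: bigcup_measurable => k _; exact: mXZD.
  rewrite setI_bigcupr measure_bigcup//=; last 2 first.
  + by move=> k _; apply: measurableI => //; exact: mXZD.
  + exact: trivIset_setIl.
  rewrite [RHS](eq_eseriesl _ (Q := xpredT)) => [|k]; last by rewrite in_setT.
  by apply: eq_eseriesr => k _; exact: IH.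
Qed.

Lemma cond_indep_pair : cond_indep P Y X Z ->
  forall A, measurable A -> exists2 f, is_cond_prob P Z (Y @^-1` A) f &
  forall D, measurable D ->
    (\int[P]_(w in XZ @^-1` D) (f w)%:E = P (Y @^-1` A `&` XZ @^-1` D))%E.
Proof.
(* The versions given by conditional independence depend on [B]. One [f] is fixed, from [B = setT],
   and almost sure uniqueness later identifies it with the others. *)
move=> YXZ A mA; have [_ [f [_ [_ fA _ _]]]] := YXZ _ _ mA measurableT.
exists f => //; apply: is_cond_prob_pair => [|//|B C mB mC]; first exact: mYA.
have [fAB [fA' [fB [hAB hA hB fM]]]] := YXZ _ _ mA mB.
have [g gB gM] := cond_prob_pull_out_exists P mZ (mXB mB).
have [mf fi _] := fA; have [mfAB fABi fABE] := hAB.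
have [fgi fgE] := gM _ mf fi.
rewrite setIA -fABE; last exact: ZC.
rewrite [X in (\int[_]_(_ in X) _)%E]setIC -fgE; last exact: ZC.
apply: ae_eq_integral.
- exact: mZC.
- exact/measurable_funTS/(measurable_int _ fgi).
- exact/measurable_funTS/(measurable_int _ fABi).
have fA'E := cond_prob_ae_unique mZ fA hA.
have gE := cond_prob_ae_unique mZ gB hB.
by apply: filterS3 fM fA'E gE => w /= -> -> -> _.
Qed.

(** Converse of [cond_indep_pair], from rectangles only. By pulling out, [f * g] is a version of P(Y
    in A, X in B | Z), so the factorization holds everywhere for these versions. *)
Lemma pair_cond_indep : (forall A, measurable A ->
    exists2 f, is_cond_prob P Z (Y @^-1` A) f &
      forall B C, measurable B -> measurable C ->
      (\int[P]_(w in X @^-1` B `&` Z @^-1` C) (f w)%:E =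
       P (Y @^-1` A `&` (X @^-1` B `&` Z @^-1` C)))%E) ->
  cond_indep P Y X Z.
Proof.
move=> YXZ A B mA mB; have [f fA fXZ] := YXZ A mA.
have [g gB gM] := cond_prob_pull_out_exists P mZ (mXB mB).
have [mf fi _] := fA; have [mg gi _] := gB.
have [fgi fgE] := gM _ mf fi.
exists (f \* g), f, g; split => //; last exact: aeW.
split => //; first exact: measurable_funM.
move=> _ [C mC <-]; rewrite setTI fgE; last exact: ZC.
by rewrite [X in (\int[_]_(_ in X) _)%E]setIC fXZ// setIA.
Qed.

End cond_indep_theory.

(* Z being a function of Z' := g(X, Z), P(Y in A | Z) is sigma(Z')-measurable;
   its integral over every event of sigma(X, Z), a fortiori over every event of
   sigma(Z'), is that of the indicator of (Y in A), so it is also a version of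
   P(Y in A | Z'). *)
Lemma cond_indep_transfer {R : realType} {d : measure_display}
    {T : measurableType d} (P : probability T R)
    {d1 d2 d3 d4 d5 : measure_display} {T1 : measurableType d1}
    {T2 : measurableType d2} {T3 : measurableType d3}
    {T4 : measurableType d4} {T5 : measurableType d5}
    (Y : T -> T1) (X : T -> T2) (Z : T -> T3)
    (f : T2 * T3 -> T4) (g : T2 * T3 -> T5) (h : T5 -> T3) :
  measurable_fun [set: T] Y -> measurable_fun [set: T] X ->
  measurable_fun [set: T] Z -> measurable_fun [set: T2 * T3] f ->
  measurable_fun [set: T2 * T3] g -> measurable_fun [set: T5] h ->
  (forall w, Z w = h (g (X w, Z w))) ->
  cond_indep P Y X Z ->
  cond_indep P Y (fun w => f (X w, Z w)) (fun w => g (X w, Z w)).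
Proof.
move=> mY mX mZ mf mg mh ZE YXZ.
have mXZ : measurable_fun [set: T] (fun w => (X w, Z w)).
  exact: measurable_fun_pair.
apply: pair_cond_indep => //; [exact: measurableT_comp mXZ..|move=> A mA].
have [u [mu ui uE] uXZ] := cond_indep_pair mY mX mZ YXZ mA.
have uXZ' B C : measurable B -> measurable C ->
  (\int[P]_(w in (fun w => f (X w, Z w)) @^-1` B `&`
                 (fun w => g (X w, Z w)) @^-1` C) (u w)%:E =
   P (Y @^-1` A `&` ((fun w => f (X w, Z w)) @^-1` B `&`
                 (fun w => g (X w, Z w)) @^-1` C)))%E.
  move=> mB mC; apply: (uXZ (f @^-1` B `&` g @^-1` C)).
  rewrite -[f @^-1` B]setTI -[g @^-1` C]setTI.
  by apply: measurableI; [exact: mf|exact: mg].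
exists u => //; split => //.
- move=> _ B mB; rewrite setTI.
  have [|C mC CB] := mu _ B mB; first exact: measurableT.
  rewrite !setTI in CB; exists (h @^-1` C).
    by rewrite -[h @^-1` C]setTI; exact: mh.
  by rewrite setTI -CB; apply/seteqP; split => w /=; rewrite -ZE.
- move=> _ [C mC <-]; have := uXZ' _ _ measurableT mC.
  by rewrite !preimage_setT !setTI.
Qed.

(** * Orthogonal projections and complements *)

Section orth_proj_theory.
Context {R : realType} {p : nat}.
Implicit Types (S H : {vspace 'rV[R]_p}).

(** This presents Q_H X as a projection of X, the form that a dimension reduction subspace
    requires. *)
Lemma orth_proj_orthov H v :
  orth_proj (orthov (@dotrv R p) H) v = orth_coproj H v.
Proof.
have /orth_projP[PH Hv] := erefl (orth_proj H v).
apply/esym/orth_projP; rewrite /orth_coproj add_lfunE opp_lfunE id_lfunE; split.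
  exact/mem_orthovP.
move=> s sH; rewrite subKr; move/mem_orthovP: sH => /(_ _ PH).
by rewrite hermC /= mul1r.
Qed.

Lemma orth_proj_eq0 H v :
  (orth_proj H v == 0) = (v \in orthov (@dotrv R p) H).
Proof.
apply/eqP/mem_orthovP => [Hv0 u uH|vH].
  have /esym/orth_projP[_ /(_ u uH)] := Hv0.
  by rewrite subr0.
apply/esym/orth_projP; split; first exact: mem0v.
by move=> s sH; rewrite subr0; exact: vH.
Qed.

(** P_S kills the image of P_H, since H is orthogonal to S. Hence P_S X is a function of Q_H X. *)
Lemma orth_proj_coproj S H v : (S <= orthov (@dotrv R p) H)%VS ->
  orth_proj S (orth_coproj H v) = orth_proj S v.
Proof.
move=> SH; rewrite /orth_coproj add_lfunE opp_lfunE id_lfunE linearB /=.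
have -> : orth_proj S (orth_proj H v) = 0.
  have /orth_projP[PH _] := erefl (orth_proj H v).
  apply/eqP; rewrite orth_proj_eq0; apply/mem_orthovP => s sS.
  have /mem_orthovP/(_ _ PH) := subvP SH _ sS.
  by rewrite hermC /= mul1r.
by rewrite subr0.
Qed.

Lemma orth_proj_add_coproj H v : orth_proj H v + orth_coproj H v = v.
Proof. by rewrite /orth_coproj add_lfunE opp_lfunE id_lfunE addrC subrK. Qed.

End orth_proj_theory.

Theorem proposition1 (R : realType) (d : measure_display)
    (T : measurableType d) (P : probability T R) (p : nat)
    (Y : {RV P >-> R}) (X : {RV P >-> 'rV[R]_p}) (H : {vspace 'rV[R]_p}) :
  central_subspace_exists Y X ->
  (orth_proj H @` central_subspace Y X = [set 0] <->
   cond_indep P Y (orth_proj H \o X) (orth_coproj H \o X)).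
Proof.
(* By existence, the central subspace is the carrier of [S], itself a dimension reduction
   subspace. *)
move=> [S YXS SE]; rewrite -SE.
have mL (f : 'End('rV[R]_p)) : measurable_fun [set: 'rV[R]_p] f.
  exact: measurable_linear_rV.
have mX : measurable_fun [set: T] X by exact: measurable_funP.
have mY : measurable_fun [set: T] Y by exact: measurable_funP.
have mLX (f : 'End('rV[R]_p)) : measurable_fun [set: T] (f \o X).
  exact: measurableT_comp.
split=> [HS0|YHX].
  have SH : (S <= orthov (@dotrv R p) H)%VS.
    apply/subvP => v vS; rewrite -orth_proj_eq0; apply/eqP.
    suff : [set 0] (orth_proj H v) by [].
    by rewrite -HS0; exists v.
  (* The transfer starts from the pair (X, P_S X), of which [f] and [g] read only X; [h] recovers
     P_S X from Q_H X. *)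
  apply: (cond_indep_transfer
    (f := fun v : 'rV[R]_p * 'rV[R]_p => orth_proj H v.1)
    (g := fun v : 'rV[R]_p * 'rV[R]_p => orth_coproj H v.1)
    (h := orth_proj S) mY mX (mLX _)) => //.
  - exact: (measurableT_comp (mL _)).
  - exact: (measurableT_comp (mL _)).
  - by move=> w /=; rewrite orth_proj_coproj.
  - exact: YXS.
have YXH : dim_reduction_subspace Y X (orthov (@dotrv R p) H).
  rewrite /dim_reduction_subspace.
  have -> : orth_proj (orthov (@dotrv R p) H) \o X = orth_coproj H \o X.
    by apply/funext => w /=; rewrite orth_proj_orthov.
  (* Only the X tested for independence is split as P_H X + Q_H X; the conditioning variable Q_H X
     is kept, so [g] is [snd] and [h] the identity. *)
  rewrite [X in cond_indep _ _ X _](_ : _ =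
      (fun w => (orth_proj H \o X) w + (orth_coproj H \o X) w)).
    apply: (cond_indep_transfer (f := fun v : 'rV[R]_p * 'rV[R]_p => v.1 + v.2)
      (g := snd) (h := @id 'rV[R]_p) mY (mLX (orth_proj H))) => //.
    - exact: mLX.
    - exact: measurable_addrv.
  by apply/funext => w /=; rewrite orth_proj_add_coproj.
(* The zero vector of [S] shows that 0 is attained. Conversely, [S] is an intersection having the
   orthogonal complement of H among its members, and P_H vanishes there. *)
apply/seteqP; split => [_ [v + <-]|_ ->] /=; last first.
  by exists 0; [exact: mem0v|rewrite linear0].
by rewrite SE => /(_ _ YXH) /=; rewrite -orth_proj_eq0 => /eqP.
Qed.
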